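(* Let $X$ be a uniformly discrete metric space with bounded geometry that admits a fibred coarse embedding into Hilbert space. Then the associated boundary groupoid $G(X)|_{\partial\beta X}$ is a-T-menable.
   Context: **Metric spaces.** A metric space $X$ is uniformly discrete if there is $c>0$ with $d(x,y)>c$ for all distinct $x,y\in X$. It has bounded geometry if for every $R>0$ there is $N_R>0$ such that every ball of radius $R$ in $X$ has cardinality smaller than $N_R$. **Fibred coarse embedding.** A metric space $X$ admits a fibred coarse embedding into Hilbert space if there exist: a field of Hilbert spaces $\{H_x\}_{x\in X}$ over $X$; a section $s:X\to\sqcup_{x\in X}H_x$ (i.e. $s(x)\in H_x$); two non-decreasing functions $\rho_1,\rho_2:[0,\infty)\to(-\infty,+\infty)$ with $\lim_{r\to\infty}\rho_i(r)=\infty$ for $i=1,2$; and a reference Hilbert space $H$; such that for any $r>0$ there exist a bounded subset $K_r\subset X$ and, for each $C\subset X\setminus K_r$ of diameter less than $r$, a trivialisation $t_C:\sqcup_{x\in C}H_x\to C\times H$ whose restriction $t_C(x)$ to each $H_x$ is an affine isometry from $H_x$ to $H$, satisfying: (1) for any $x,y\in C$, $\rho_1(d(x,y))\le\|t_C(x)(s(x))-t_C(y)(s(y))\|\le\rho_2(d(x,y))$; (2) for any two subsets $C_1,C_2\subset X\setminus K_r$ of diameter less than $r$ with $C_1\cap C_2\neq\emptyset$ there exists an affine isometry $t_{C_1,C_2}:H\to H$ such that $t_{C_1}(x)t_{C_2}(x)^{-1}=t_{C_1,C_2}$ for all $x\in C_1\cap C_2$. **Coarse groupoid and boundary groupoid.**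 For $R>0$ let $\Delta_R=\{(x,y)\in X\times X: d(x,y)\le R\}$. Let $\beta$ denote Stone–Čech compactification and set $G(X)=\bigcup_{R>0}\overline{\Delta_R}\subseteq\beta(X\times X)$, a locally compact Hausdorff space (topologised as the union of the open subsets $\overline{\Delta_R}$). The map $(r,s)$ extends to $\beta(X\times X)\to\beta X\times\beta X$ and embeds each $\overline{\Delta_R}$ in $\beta X\times\beta X$; $G(X)$ carries the product and inverse induced from the pair groupoid $\beta X\times\beta X$, making it an étale topological groupoid with unit space $\beta X$. The set $X\subset\beta X$ is open and saturated, so $\partial\beta X=\beta X\setminus X$ is closed and saturated. The boundary groupoid is the restriction $G(X)|_{\partial\beta X}$; as a set it is $\bigcup_{R>0}\overline{\Delta_R}\setminus\Delta_R$. **A-T-menability.** For a locally compact Hausdorff groupoid $\mathcal G$, a continuous function $F:\mathcal G\to\mathbb R$ is of negative type if (i) $F|_{\mathcal G^{(0)}}=0$; (ii) $F(x)=F(x^{-1})$ for all $x\in\mathcal G$; (iii) for all $x_1,\dots,x_n\in\mathcal G$ with the same range and $\sigma_1,\dots,\sigma_n\in\mathbb R$ with $\sum_i\sigma_i=0$, $\sum_{j,k}\sigma_j\sigma_kF(x_j^{-1}x_k)\le0$. A $\sigma$-compact étale groupoid with compact Hausdorff unit space is a-T-menable if it carries a proper continuous function of negative type (equivalently, by work of Tu, if it acts properly by affine isometries on a continuous field of Hilbert spaces over its unit space). *)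

(* Defs.v *)
From HB Require Import structures.
From mathcomp Require Import all_boot all_order all_algebra finmap.
From mathcomp Require Import all_classical all_reals all_analysis.

Set Implicit Arguments.
Unset Strict Implicit.
Unset Printing Implicit Defensive.

Import Order.TTheory GRing.Theory Num.Theory.
Import numFieldNormedType.Exports.

Local Open Scope classical_set_scope.
Local Open Scope ring_scope.

(** * Metric spaces *)

Section MetricSpaces.
Context {R : realType} (X : metricType R).

Definition uniformly_discrete :=
  exists2 c : R, 0 < c & forall x y : X, x <> y -> c < mdist x y.

Definition bounded_geometry :=
  forall r : R, 0 < r -> exists N : nat, forall x : X,
    finite_set (ball x r) /\ (#|` fset_set (ball x r)| < N)%N.

(* The diameter of the empty set is -oo. *)
Definition diameter (C : set X) : \bar R :=
  ereal_sup [set (mdist p.1 p.2)%:E | p in C `*` C].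

Definition metric_bounded (C : set X) := exists M : R,
  forall x y, C x -> C y -> mdist x y <= M.

End MetricSpaces.

(** * Hilbert spaces and fibred coarse embeddings *)

(* Real Hilbert spaces; a complex one is covered by restriction of scalars. *)
Record hilbertSpace (R : realType) := HilbertSpace {
  hilbert_sort :> completeNormedModType R;
  inner : {dot hilbert_sort for idfun};
  inner_norm : forall v : hilbert_sort, inner v v = `|v| ^+ 2
}.

(* Affine isometries are onto here: the inverse of each t_C(x) is used. *)
Definition affine_isometry (R : realType) (H K : hilbertSpace R) (f : H -> K) :=
  [/\ exists (L : {linear H -> K}) (b : K), forall v, f v = L v + b,
      forall v w, `|f v - f w| = `|v - w| & bijective f].

(* t C x is only meaningful when x \in C, C is disjoint from K and has diameter
   less than r. Since every t C2 x is a bijection, the last clause says that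
   t C1 x \o (t C2 x)^-1 = T. *)
Definition fibred_coarse_embedding (R : realType) (X : metricType R) :=
  exists (E : X -> hilbertSpace R) (s : forall x, E x) (rho1 rho2 : R -> R)
      (H : hilbertSpace R),
  [/\ {in `[0, +oo[ &, {homo rho1 : a b / a <= b}},
      {in `[0, +oo[ &, {homo rho2 : a b / a <= b}},
      rho1 a @[a --> +oo] --> +oo, rho2 a @[a --> +oo] --> +oo &
      forall r : R, 0 < r ->
      exists (K : set X) (t : set X -> forall x, E x -> H),
      let small C := C `<=` ~` K /\ (diameter C < r%:E)%E in
      [/\ metric_bounded K,
          forall C x, small C -> C x -> affine_isometry (t C x),
          forall C x y, small C -> C x -> C y ->
            rho1 (mdist x y) <= `|t C x (s x) - t C y (s y)| <= rho2 (mdist x y) &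
          forall C1 C2, small C1 -> small C2 -> C1 `&` C2 !=set0 ->
            exists2 T : H -> H, affine_isometry T &
              forall x, (C1 `&` C2) x -> t C1 x = T \o t C2 x]].

(** * Stone-Cech compactification of a discrete space *)

(* The points are the ultrafilters on T, and the sets [set u | u A] form a base
   of the topology. The universal property is beta_extension below. *)
Record beta (T : Type) := Beta {
  beta_val :> set T -> Prop;
  beta_ultra : @UltraFilter T beta_val
}.
#[global] Existing Instance beta_ultra.

HB.instance Definition _ T := gen_eqMixin (beta T).
HB.instance Definition _ T := gen_choiceMixin (beta T).

Section BetaTopology.
Variable T : Type.

Definition beta_op : set_system (beta T) := [set U | forall u : beta T, U u ->
  exists2 A, u A & [set v : beta T | v A] `<=` U].

Let beta_opT : beta_op setT.
Proof. by move=> u _; exists setT => //; exact: filterT. Qed.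

Let beta_opI : setI_closed beta_op.
Proof.
move=> U V oU oV u [/oU [A uA AU] /oV [B uB BV]].
exists (A `&` B); first exact: filterI.
move=> v /= vAB; split.
- by apply: AU => /=; apply: filterS vAB => x [].
- by apply: BV => /=; apply: filterS vAB => x [].
Qed.

Let beta_op_bigU (I : Type) (f : I -> set (beta T)) :
  (forall i, beta_op (f i)) -> beta_op (\bigcup_i f i).
Proof.
move=> of_ u [i _ /of_[A uA Af]]; exists A => // v /Af fv.
by exists i.
Qed.

HB.instance Definition _ := isOpenTopological.Build (beta T)
  beta_opT beta_opI beta_op_bigU.

End BetaTopology.

Definition beta_eta {T : Type} (x : T) : beta T :=
  Beta (principal_filter_ultra x).

Section BetaTheory.
Context {T : Type}.
Implicit Types (u v : beta T) (A B : set T).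

Lemma beta_openE : @open (beta T) = beta_op (T := T).
Proof. by []. Qed.

Lemma beta_eq u v : (forall A, u A -> v A) -> u = v.
Proof.
move=> uv; have E : beta_val v = beta_val u by apply: (@max_filter _ (beta_val u)).
case: u v E {uv} => [F UF] [G UG] /= E; subst G; congr Beta; exact: Prop_irrelevance.
Qed.

Lemma betaI u A B : u A -> u B -> u (A `&` B).
Proof. exact: filterI. Qed.

Lemma betaS u A B : A `<=` B -> u A -> u B.
Proof. exact: filterS. Qed.

Lemma betaT u : u setT.
Proof. exact: filterT. Qed.

Lemma beta_nonempty u A : u A -> A !=set0.
Proof. exact: (@filter_ex _ (beta_val u)). Qed.

Lemma beta_dec u A : u A \/ u (~` A).
Proof. exact: in_ultra_setVsetC. Qed.

Lemma beta_notC u A : u A -> ~ u (~` A).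
Proof. by move=> uA uC; have [x []] := beta_nonempty (betaI uA uC). Qed.

Lemma beta_etaE (x : T) A : beta_eta x A <-> A x.
Proof. exact: principal_filterP. Qed.

Lemma beta_eta_set1 u (x : T) : u [set x] -> u = beta_eta x.
Proof.
move=> ux; apply/esym/beta_eq => A /beta_etaE Ax.
by apply: betaS ux => y ->.
Qed.

Lemma beta_open A : open [set u : beta T | u A].
Proof. by rewrite beta_openE => u uA; exists A. Qed.

Lemma beta_closed A : closed [set u : beta T | u A].
Proof.
rewrite -openC (_ : ~` _ = [set u : beta T | u (~` A)]); first exact: beta_open.
rewrite eqEsubset; split=> u /=; first by case: (beta_dec u A).
by move=> uC uA; exact: (beta_notC uA).
Qed.

Lemma beta_nbhs u (U : set (beta T)) :
  nbhs u U <-> exists2 A, u A & [set v : beta T | v A] `<=` U.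
Proof.
rewrite nbhsE; split.
  by move=> [V [oV Vu] VU]; have [A uA AV] := oV _ Vu; exists A => // v /AV/VU.
by move=> [A uA AU]; exists [set v : beta T | v A] => //; split=> //; exact: beta_open.
Qed.

Lemma beta_ex (G : set_system T) : G !=set0 -> (forall A, G A -> A !=set0) ->
  (forall A B, G A -> G B -> exists2 C, G C & C `<=` A `&` B) ->
  exists u, G `<=` u.
Proof.
move=> [A0 GA0] Gn0 GI.
have PF : ProperFilter (filter_from G id).
  apply: filter_from_proper => //; apply: filter_from_filter; first by exists A0.
  by move=> A B /GI/[apply] -[C GC CAB]; exists C.
have [F [UF GF]] := ultraFilterLemma PF.
by exists (Beta UF) => A GA; apply: GF; exists A.
Qed.

Lemma beta_hausdorff : hausdorff_space (beta T).
Proof.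
move=> u v uv; apply: beta_eq => A uA.
have [//|vC] := beta_dec v A.
have nu : nbhs u [set w : beta T | w A] by apply/beta_nbhs; exists A.
have nv : nbhs v [set w : beta T | w (~` A)] by apply/beta_nbhs; exists (~` A).
by have [w [/= wA /(beta_notC wA)]] := uv _ _ nu nv.
Qed.

Lemma beta_compact : compact [set: beta T].
Proof.
rewrite compact_ultra => F UF _.
pose G : set_system T := [set A | F [set u : beta T | u A]].
have [u Gu] : exists u, G `<=` u.
  apply: beta_ex.
  - by exists setT; rewrite /G /=; apply: filterS (@filterT _ F _) => v _; exact: betaT.
  - by move=> A GA; have [v /beta_nonempty] := filter_ex (GA : F _).
  - move=> A B GA GB; exists (A `&` B) => //; rewrite /G /=.
    by apply: (@filterS _ F _ _ _ _ (@filterI _ F _ _ _ GA GB)) => v [/= vA vB]; exact: betaI.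
exists u; split=> //= U /beta_nbhs [A uA AU]; apply: filterS AU _.
have [//|FnA] := in_ultra_setVsetC [set v : beta T | v A] UF.
have /Gu uC : G (~` A).
  by apply: filterS FnA => v /=; case: (beta_dec v A).
by have := beta_notC uA uC.
Qed.

Lemma beta_dense : dense (range (@beta_eta T)).
Proof.
move=> U [u Uu] oU; have [A uA AU] := oU _ Uu.
have [x Ax] := beta_nonempty uA.
by exists (beta_eta x); split; [apply: AU; exact/beta_etaE|exists x].
Qed.

Lemma beta_closureP A u : closure (beta_eta @` A) u <-> u A.
Proof.
split.
  move=> cu; have [//|uC] := beta_dec u A.
  have nu : nbhs u [set w : beta T | w (~` A)] by apply/beta_nbhs; exists (~` A).
  by have [_ [[x Ax <-] /beta_etaE]] := cu _ nu.
move=> uA U /beta_nbhs[B uB BU]; have [x [Ax Bx]] := beta_nonempty (betaI uA uB).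
by exists (beta_eta x); split; [exists x|apply: BU; exact/beta_etaE].
Qed.

End BetaTheory.

Lemma beta_map_ultra (S T : Type) (f : S -> T) (u : beta S) :
  UltraFilter [set A | u (f @^-1` A)].
Proof.
have PF : ProperFilter [set A | u (f @^-1` A)].
  exact: (@fmap_proper_filter _ _ f (beta_val u)).
split=> // G PG fG; apply/seteqP; split => // A GA.
have [//|uC] := beta_dec u (f @^-1` A).
have /(filterI GA) : G (~` A) by apply: fG.
by rewrite setICr => /filter_ex[].
Qed.

Definition beta_map (S T : Type) (f : S -> T) (u : beta S) : beta T :=
  Beta (beta_map_ultra f u).

Lemma beta_map_continuous (S T : Type) (f : S -> T) : continuous (beta_map f).
Proof.
move=> u U /beta_nbhs[A uA AU]; apply/beta_nbhs.
by exists (f @^-1` A) => // v vA; exact: AU.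
Qed.

Lemma beta_map_eta (S T : Type) (f : S -> T) (x : S) :
  beta_map f (beta_eta x) = beta_eta (f x).
Proof. by apply: beta_eq => A /beta_etaE Ax; exact/beta_etaE. Qed.

Lemma beta_extension (T : Type) (K : topologicalType) (f : T -> K) :
  compact [set: K] -> hausdorff_space K ->
  exists! g : beta T -> K, continuous g /\ forall x, g (beta_eta x) = f x.
Proof.
move=> cK hK.
have lim (u : beta T) : exists p : K, nbhs p `<=` beta_val (beta_map f u).
  have := cK; rewrite compact_ultra => /(_ _ (beta_ultra (beta_map f u))).
  by case=> [|p [_ fp]]; [exact: betaT|exists p].
have [g gP] := choice lim; exists g.
have gc : continuous g.
  move=> u U /= nU.
  have [V nV VU] : exists2 V, nbhs (g u) V & closure V `<=` U.
    by apply: (@compact_regular K (g u) setT) nU => //; exact: filterT.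
  apply/beta_nbhs; exists (f @^-1` V); first exact: (gP u _ nV).
  move=> v vV; apply: VU => W nW.
  by have /beta_nonempty[x [? ?]] := betaI vV (gP v _ nW : v (f @^-1` W)); exists (f x).
have ge x : g (beta_eta x) = f x.
  apply: hK => A B nA nB; exists (f x); split; last exact: nbhs_singleton.
  by have /beta_etaE := gP _ _ nA.
split=> // h [hc he]; apply/funext => u; apply: hK => A B nA nB.
have nu : nbhs u (g @^-1` A `&` h @^-1` B).
  by apply: filterI; [exact: (gc u _ nA)|exact: (hc u _ nB)].
have [C uC CAB] := (beta_nbhs _ _).1 nu; have [x Cx] := beta_nonempty uC.
have /= [] : (g @^-1` A `&` h @^-1` B) (beta_eta x) by apply: CAB; exact/beta_etaE.
by rewrite ge he => ? ?; exists (f x).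
Qed.

(** * Topological groupoids *)

(* The composition mul g h is only meaningful when src g = rng h. *)
Record topologicalGroupoid := TopologicalGroupoid {
  unit_space : topologicalType;
  arrow :> topologicalType;
  rng : arrow -> unit_space;
  src : arrow -> unit_space;
  idn : unit_space -> arrow;
  inv : arrow -> arrow;
  mul : arrow -> arrow -> arrow;
  rng_idn : forall u, rng (idn u) = u;
  src_idn : forall u, src (idn u) = u;
  rng_inv : forall g, rng (inv g) = src g;
  src_inv : forall g, src (inv g) = rng g;
  rng_mul : forall g h, src g = rng h -> rng (mul g h) = rng g;
  src_mul : forall g h, src g = rng h -> src (mul g h) = src h;
  mulA : forall g h k, src g = rng h -> src h = rng k ->
    mul g (mul h k) = mul (mul g h) k;
  mul_idl : forall g, mul (idn (rng g)) g = g;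
  mul_idr : forall g, mul g (idn (src g)) = g;
  mul_invr : forall g, mul g (inv g) = idn (rng g);
  mul_invl : forall g, mul (inv g) g = idn (src g);
  rng_continuous : continuous rng;
  src_continuous : continuous src;
  idn_continuous : continuous idn;
  inv_continuous : continuous inv;
  mul_continuous : {within [set p : arrow * arrow | src p.1 = rng p.2],
    continuous (fun p => mul p.1 p.2)}
}.

Definition etale (G : topologicalGroupoid) := forall g : G, exists U : set G,
  [/\ open U, U g, {in U &, injective (@rng G)} &
      forall V, V `<=` U -> open V -> open (@rng G @` V)].

Definition sigma_compact (T : topologicalType) := exists K : nat -> set T,
  (forall n, compact (K n)) /\ \bigcup_n K n = [set: T].

Definition proper_map (S T : topologicalType) (f : S -> T) :=
  forall K, compact K -> compact (f @^-1` K).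

Definition negative_type (R : realType) (G : topologicalGroupoid) (F : G -> R) :=
  [/\ forall u, F (idn u) = 0,
      forall g, F g = F (inv g) &
      forall (n : nat) (x : 'I_n -> G) (sigma : 'I_n -> R),
        (forall j k, rng (x j) = rng (x k)) -> \sum_j sigma j = 0 ->
        \sum_j \sum_k sigma j * sigma k * F (mul (inv (x j)) (x k)) <= 0].

Definition a_T_menable (R : realType) (G : topologicalGroupoid) :=
  exists F : G -> R, [/\ continuous F, proper_map F & negative_type F].

Lemma nbhs_set_type (T : topologicalType) (A : set T) (x : A) (U : set A) :
  nbhs x U <-> exists2 V, nbhs (val x) V & val @^-1` V `<=` U.
Proof.
split.
  move=> [_ [[V oV <-] /= Vx VU]]; exists V => //.
  by rewrite nbhsE; exists V => //.
rewrite nbhsE => -[V [W [oW Wx] WV] VU].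
exists (val @^-1` W); split => //; first by exists W.
by move=> y /WV/VU.
Qed.

Lemma set_type_continuous (S T : topologicalType) (A : set T) (f : S -> A) :
  continuous (val \o f : S -> T) -> continuous f.
Proof.
move=> cf x U /nbhs_set_type[V nV VU].
by apply: (@filterS _ (nbhs x) _ (fun y => V (val (f y)))) (cf x V nV) => y /VU.
Qed.

Lemma val_set_continuous (T : topologicalType) (A : set T) :
  continuous (val : A -> T).
Proof. by move=> x U nU; apply/nbhs_set_type; exists U. Qed.

Definition mksub (T : Type) (A : set T) (x : T) (Ax : A x) : A :=
  exist _ x (mem_set Ax).

Section Restriction.
Variables (G : topologicalGroupoid) (Y : set (unit_space G)).

Definition restr_arrow : set G := [set g | Y (rng g) /\ Y (src g)].

Implicit Types (g h k : restr_arrow) (u : Y).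

Definition restr_rng g : Y := mksub (set_valP g).1.
Definition restr_src g : Y := mksub (set_valP g).2.

Let restr_idn_subproof u : restr_arrow (idn (val u)).
Proof. by split; rewrite ?rng_idn ?src_idn; exact: set_valP. Qed.
Definition restr_idn u : restr_arrow := mksub (restr_idn_subproof u).

Let restr_inv_subproof g : restr_arrow (inv (val g)).
Proof. by have [? ?] := set_valP g; split; rewrite ?rng_inv ?src_inv. Qed.
Definition restr_inv g : restr_arrow := mksub (restr_inv_subproof g).

Definition restr_mul g h : restr_arrow :=
  xget g [set k : restr_arrow | val k = mul (val g) (val h)].

Let val_mul g h : restr_src g = restr_rng h ->
  val (restr_mul g h) = mul (val g) (val h).
Proof.
move=> /(congr1 val)/= gh; rewrite /restr_mul.
have E : restr_arrow (mul (val g) (val h)).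
  have [? ?] := set_valP g; have [? ?] := set_valP h.
  by split; rewrite ?rng_mul ?src_mul.
exact: (@xgetI _ g [set k : restr_arrow | val k = _] (mksub E)).
Qed.

Let r_rng_idn u : restr_rng (restr_idn u) = u.
Proof. by apply: val_inj; rewrite /= rng_idn. Qed.
Let r_src_idn u : restr_src (restr_idn u) = u.
Proof. by apply: val_inj; rewrite /= src_idn. Qed.
Let r_rng_inv g : restr_rng (restr_inv g) = restr_src g.
Proof. by apply: val_inj; rewrite /= rng_inv. Qed.
Let r_src_inv g : restr_src (restr_inv g) = restr_rng g.
Proof. by apply: val_inj; rewrite /= src_inv. Qed.
Let r_rng_mul g h : restr_src g = restr_rng h ->
  restr_rng (restr_mul g h) = restr_rng g.
Proof.
move=> gh; apply: val_inj; rewrite /= val_mul// rng_mul//.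
exact: (congr1 val gh).
Qed.
Let r_src_mul g h : restr_src g = restr_rng h ->
  restr_src (restr_mul g h) = restr_src h.
Proof.
move=> gh; apply: val_inj; rewrite /= val_mul// src_mul//.
exact: (congr1 val gh).
Qed.
Let r_mulA g h k : restr_src g = restr_rng h -> restr_src h = restr_rng k ->
  restr_mul g (restr_mul h k) = restr_mul (restr_mul g h) k.
Proof.
move=> gh hk; apply: val_inj.
rewrite !val_mul ?r_src_mul ?r_rng_mul// mulA//.
- exact: (congr1 val gh).
- exact: (congr1 val hk).
Qed.
Let r_mul_idl g : restr_mul (restr_idn (restr_rng g)) g = g.
Proof. by apply: val_inj; rewrite val_mul ?r_src_idn//= mul_idl. Qed.
Let r_mul_idr g : restr_mul g (restr_idn (restr_src g)) = g.
Proof. by apply: val_inj; rewrite val_mul ?r_rng_idn//= mul_idr. Qed.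
Let r_mul_invr g : restr_mul g (restr_inv g) = restr_idn (restr_rng g).
Proof. by apply: val_inj; rewrite val_mul ?r_rng_inv//= mul_invr. Qed.
Let r_mul_invl g : restr_mul (restr_inv g) g = restr_idn (restr_src g).
Proof. by apply: val_inj; rewrite val_mul ?r_src_inv//= mul_invl. Qed.

Let r_rng_continuous : continuous restr_rng.
Proof.
apply: set_type_continuous => g; apply: continuous_comp.
  exact: val_set_continuous.
exact: rng_continuous.
Qed.
Let r_src_continuous : continuous restr_src.
Proof.
apply: set_type_continuous => g; apply: continuous_comp.
  exact: val_set_continuous.
exact: src_continuous.
Qed.
Let r_idn_continuous : continuous restr_idn.
Proof.
apply: set_type_continuous => g; apply: continuous_comp.
  exact: val_set_continuous.
exact: idn_continuous.
Qed.
Let r_inv_continuous : continuous restr_inv.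
Proof.
apply: set_type_continuous => g; apply: continuous_comp.
  exact: val_set_continuous.
exact: inv_continuous.
Qed.
Let r_mul_continuous :
  {within [set p : restr_arrow * restr_arrow | restr_src p.1 = restr_rng p.2],
    continuous (fun p => restr_mul p.1 p.2)}.
Proof.
apply/subspace_continuousP => -[g h] /= gh U /nbhs_set_type[V nV VU].
have /subspace_continuousP cm := @mul_continuous G.
move: nV; rewrite (val_mul gh) => nV.
have [[A B] /= [nA nB] AB] := cm (val g, val h) (congr1 val gh) _ nV.
exists (val @^-1` A, val @^-1` B).
  by split; apply/nbhs_set_type; [exists A|exists B].
move=> [g' h'] /= [Ag Bh] gh'; apply: VU; rewrite /= (val_mul gh').
by apply: (AB (val g', val h')) => //; exact: (congr1 val gh').
Qed.

Definition restriction : topologicalGroupoid :=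
  TopologicalGroupoid r_rng_idn r_src_idn r_rng_inv r_src_inv r_rng_mul r_src_mul
    r_mulA r_mul_idl r_mul_idr r_mul_invr r_mul_invl r_rng_continuous
    r_src_continuous r_idn_continuous r_inv_continuous r_mul_continuous.

End Restriction.

(** * The coarse groupoid and the boundary groupoid *)

Section CoarseGroupoid.
Context {R : realType} (X : metricType R).

Definition Delta (r : R) : set (X * X) := [set p | mdist p.1 p.2 <= r].

(* Each closure below is open in beta (X * X), so the topology of the union of
   these open sets is the subspace topology. *)
Definition coarse_arrow : set (beta (X * X)) :=
  \bigcup_(r in [set r : R | 0 < r]) closure (beta_eta @` Delta r).

Implicit Types (g h k : coarse_arrow) (u : beta X).

Definition coarse_rng g : beta X := beta_map fst (val g).
Definition coarse_src g : beta X := beta_map snd (val g).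

Lemma coarse_arrowP (w : beta (X * X)) :
  coarse_arrow w <-> exists2 r, 0 < r & w (Delta r).
Proof.
by split=> -[r r0 wr]; exists r => //; exact/beta_closureP.
Qed.

Lemma Delta_le (r r' : R) : r <= r' -> Delta r `<=` Delta r'.
Proof. by move=> rr' p /= pr; exact: le_trans rr'. Qed.

Let coarse_idn_subproof u : coarse_arrow (beta_map (fun x => (x, x)) u).
Proof.
apply/coarse_arrowP; exists 1 => //=.
by apply: betaS (betaT u) => x _; rewrite /Delta /= mdistxx.
Qed.
Definition coarse_idn u : coarse_arrow := mksub (coarse_idn_subproof u).

Let coarse_inv_subproof g : coarse_arrow (beta_map (fun p => (p.2, p.1)) (val g)).
Proof.
have /coarse_arrowP[r r0 gr] := set_valP g.
apply/coarse_arrowP; exists r => //=.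
by apply: betaS gr => p; rewrite /Delta /= metric_sym.
Qed.
Definition coarse_inv g : coarse_arrow := mksub (coarse_inv_subproof g).

(* The product is the one of the pair groupoid on beta X; coarse_arrow_eq
   below says that k is unique, and coarse_mul_ex that it exists when
   coarse_src g = coarse_rng h. *)
Definition coarse_mul g h : coarse_arrow :=
  xget g [set k | coarse_rng k = coarse_rng g /\ coarse_src k = coarse_src h].

Lemma coarse_mul_ex (r s : R) (g h : beta (X * X)) : g (Delta r) -> h (Delta s) ->
  beta_map snd g = beta_map fst h ->
  exists k : beta (X * X), [/\ k (Delta (r + s)),
    beta_map fst k = beta_map fst g & beta_map snd k = beta_map snd h].
Proof.
move=> gr hs gh.
pose S (A B : set X) := [set p : X * X | [/\ A p.1, B p.2 & Delta (r + s) p]].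
pose Gs : set_system (X * X)%type := [set C | exists A B,
  [/\ beta_map fst g A, beta_map snd h B & C = S A B]].
have [] := @beta_ex _ Gs.
- by exists (S setT setT), setT, setT; split => //; exact: betaT.
- move=> _ [A [B [/= gA hB ->]]].
  pose P := [set y | exists2 x, A x & mdist x y <= r].
  pose Q := [set y | exists2 z, B z & mdist y z <= s].
  have gP : beta_map snd g P.
    by apply: betaS (betaI gA gr) => p [? ?]; exists p.1.
  have hQ : beta_map fst h Q.
    by apply: betaS (betaI hB hs) => p [? ?]; exists p.2.
  rewrite -gh in hQ.
  have [y [[x Ax xy] [z Bz yz]]] := beta_nonempty (betaI gP hQ).
  exists (x, z); split=> //=; rewrite /Delta /=.
  by rewrite (le_trans (metric_triangle _ y _))// lerD.
- move=> _ _ [A [B [gA hB ->]]] [A' [B' [gA' hB' ->]]].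
  exists (S (A `&` A') (B `&` B')).
    by exists (A `&` A'), (B `&` B'); split => //; exact: betaI.
  by move=> p [[? ?] [? ?] ?].
- move=> k Gk; exists k; split.
  + have : k (S setT setT) by apply: Gk; exists setT, setT; split=> //; exact: betaT.
    by apply: betaS => p [].
  + apply/esym/beta_eq => A gA.
    have : k (S A setT) by apply: Gk; exists A, setT; split=> //; exact: betaT.
    by apply: betaS => p [].
  + apply/esym/beta_eq => B hB.
    have : k (S setT B) by apply: Gk; exists setT, B; split=> //; exact: betaT.
    by apply: betaS => p [].
Qed.

Hypothesis Xbg : bounded_geometry X.

Lemma separated_cover (r : R) : 0 < r -> exists (N : nat) (B : 'I_N -> set X),
  (forall x, exists i, B i x) /\
  (forall i x y, B i x -> B i y -> mdist x y <= r -> x = y).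
Proof.
move=> r0; have [N NP] := Xbg (ltr_wpDr ler01 r0 : 0 < r + 1).
pose P (A : set (X * 'I_N)) :=
  (forall x i j, A (x, i) -> A (x, j) -> i = j) /\
  (forall i x y, A (x, i) -> A (y, i) -> mdist x y <= r -> x = y).
have [|A [[A1 A2] Amax]] := @Zorn_bigcup _ P.
  move=> F FP Ftot; split.
    move=> x i j [U FU Ui] [V FV Vj].
    by have [UV|VU] := Ftot _ _ FU FV;
      [have [H _] := FP _ FV|have [H _] := FP _ FU]; apply: (H x); auto.
  move=> i x y [U FU Ui] [V FV Vj].
  by have [UV|VU] := Ftot _ _ FU FV;
      [have [_ H] := FP _ FV|have [_ H] := FP _ FU]; apply: (H i); auto.
exists N, (fun i => [set x | A (x, i)]); split; last exact: A2.
move=> x; apply: contrapT => nA.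
have nAx i : ~ A (x, i) by move=> Ai; apply: nA; exists i.
have /choice[y yP] : forall i, exists y, A (y, i) /\ mdist x y <= r.
  move=> i; apply: contrapT => H; apply: (Amax (A `|` [set (x, i)])).
    by split; [left|move=> AA; apply: (nAx i); apply: AA; right].
  have Hy y : A (y, i) -> ~ mdist x y <= r by move=> ? ?; apply: H; exists y.
  split.
  - move=> z j k [zj|[-> ->]] [zk|[]]; first exact: A1 zj zk.
    + by move=> e _; move: zj; rewrite e => /nAx.
    + by move: zk => /nAx.
    + by move=> ->.
  - move=> j z z' [zj|[-> ->]] [zk|[]]; first exact: A2 zj zk.
    + by move=> -> e; move: zj; rewrite e metric_sym => /Hy.
    + by move: zk => /Hy.
    + by move=> ->.
have [fin] := NP x; rewrite ltnNge => /negP; apply.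
have -> : N = size [seq y i | i <- enum 'I_N] by rewrite size_map size_enum_ord.
apply: uniq_leq_size.
  rewrite map_inj_uniq ?enum_uniq// => i j yij.
  by apply: (A1 (y i)); [exact: (yP i).1|rewrite yij; exact: (yP j).1].
move=> _ /mapP[i _ ->]; rewrite in_fset_set// inE ballEmdist /=.
by rewrite (le_lt_trans (yP i).2)// ltrDl.
Qed.

Lemma separated_set u (r : R) : 0 < r -> exists2 B : set X, u B &
  forall x y, B x -> B y -> mdist x y <= r -> x = y.
Proof.
move=> /separated_cover[N [B [Bcov Bsep]]].
suff [i Bi] : exists i, u (B i) by exists (B i) => //; exact: Bsep.
apply: contrapT => nB.
have H i : u (~` B i) by have [Bi|//] := beta_dec u (B i); case: nB; exists i.
have Hn : u [set x | forall i, (~` B i) x].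
  exact: (@filter_forall _ 'I_N (fun i => ~` B i) (beta_val u) _ H).
have [x nx] := beta_nonempty Hn; have [i] := Bcov x; exact: nx.
Qed.

Lemma beta_pair_eq (r : R) (v w : beta (X * X)) : v (Delta r) -> w (Delta r) ->
  beta_map fst v = beta_map fst w -> beta_map snd v = beta_map snd w -> v = w.
Proof.
wlog r0 : r / 0 < r.
  move=> H vr wr; apply: (H (Num.max r 1)); first by rewrite lt_max ltr01 orbT.
  - by apply: betaS vr; apply: Delta_le; rewrite le_max lexx.
  - by apply: betaS wr; apply: Delta_le; rewrite le_max lexx.
move=> vr wr vw1 vw2; apply: beta_eq => A vA.
have [B vB Bsep] := separated_set (beta_map snd v) (addr_gt0 r0 r0).
pose C := [set p | [/\ A p, Delta r p & B p.2]].
have vC : v C by apply: betaS (betaI vA (betaI vr vB)) => p [? [? ?]].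
have w1 : w (fst @^-1` (fst @` C)).
  rewrite -[w _]/(beta_map fst w (fst @` C)) -vw1.
  by apply: betaS vC => p Cp; exists p.
have w2 : w (snd @^-1` B) by rewrite -[w _]/(beta_map snd w B) -vw2.
apply: betaS (betaI w1 (betaI w2 wr)) => -[x y] [[[x' y'] [/= Axy Dxy By'] <-]].
move=> [/= By Dy]; rewrite (Bsep _ _ By By')//.
by rewrite (le_trans (metric_triangle _ x' _))// lerD// metric_sym.
Qed.

Lemma coarse_arrow_eq g h :
  coarse_rng g = coarse_rng h -> coarse_src g = coarse_src h -> g = h.
Proof.
move=> rgh sgh; apply: val_inj.
have /coarse_arrowP[r r0 gr] := set_valP g.
have /coarse_arrowP[s s0 hs] := set_valP h.
apply: (@beta_pair_eq (Num.max r s)) => //.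
- by apply: betaS gr; apply: Delta_le; rewrite le_max lexx.
- by apply: betaS hs; apply: Delta_le; rewrite le_max lexx orbT.
Qed.

Lemma coarse_mulP g h : coarse_src g = coarse_rng h ->
  coarse_rng (coarse_mul g h) = coarse_rng g /\
  coarse_src (coarse_mul g h) = coarse_src h.
Proof.
move=> gh; apply: (@xgetPex _ g [set k | coarse_rng k = _ /\ coarse_src k = _]).
have /coarse_arrowP[r r0 gr] := set_valP g.
have /coarse_arrowP[s s0 hs] := set_valP h.
have [k [krs k1 k2]] := coarse_mul_ex gr hs gh.
have kc : coarse_arrow k by apply/coarse_arrowP; exists (r + s); rewrite ?addr_gt0.
by exists (mksub kc).
Qed.

Lemma coarse_mul_Delta (r s : R) g h : val g (Delta r) -> val h (Delta s) ->
  0 < r + s -> coarse_src g = coarse_rng h -> val (coarse_mul g h) (Delta (r + s)).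
Proof.
move=> gr hs rs gh; have [k [krs k1 k2]] := coarse_mul_ex gr hs gh.
have kc : coarse_arrow k by apply/coarse_arrowP; exists (r + s).
have [m1 m2] := coarse_mulP gh.
suff -> : coarse_mul g h = mksub kc by [].
by apply: coarse_arrow_eq; rewrite ?m1 ?m2.
Qed.

Let c_rng_idn u : coarse_rng (coarse_idn u) = u.
Proof. exact: beta_eq. Qed.
Let c_src_idn u : coarse_src (coarse_idn u) = u.
Proof. exact: beta_eq. Qed.
Let c_rng_inv g : coarse_rng (coarse_inv g) = coarse_src g.
Proof. exact: beta_eq. Qed.
Let c_src_inv g : coarse_src (coarse_inv g) = coarse_rng g.
Proof. exact: beta_eq. Qed.
Let c_rng_mul g h : coarse_src g = coarse_rng h ->
  coarse_rng (coarse_mul g h) = coarse_rng g.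
Proof. by move=> /coarse_mulP[]. Qed.
Let c_src_mul g h : coarse_src g = coarse_rng h ->
  coarse_src (coarse_mul g h) = coarse_src h.
Proof. by move=> /coarse_mulP[]. Qed.
Let c_mulA g h k : coarse_src g = coarse_rng h -> coarse_src h = coarse_rng k ->
  coarse_mul g (coarse_mul h k) = coarse_mul (coarse_mul g h) k.
Proof.
move=> gh hk; apply: coarse_arrow_eq.
- by rewrite !c_rng_mul ?c_rng_mul ?c_src_mul.
- by rewrite !c_src_mul ?c_rng_mul ?c_src_mul.
Qed.
Let c_mul_idl g : coarse_mul (coarse_idn (coarse_rng g)) g = g.
Proof. by apply: coarse_arrow_eq; rewrite ?c_rng_mul ?c_src_mul ?c_rng_idn. Qed.
Let c_mul_idr g : coarse_mul g (coarse_idn (coarse_src g)) = g.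
Proof. by apply: coarse_arrow_eq; rewrite ?c_rng_mul ?c_src_mul ?c_src_idn. Qed.
Let c_mul_invr g : coarse_mul g (coarse_inv g) = coarse_idn (coarse_rng g).
Proof.
by apply: coarse_arrow_eq;
  rewrite ?c_rng_mul ?c_src_mul ?c_rng_idn ?c_src_idn ?c_src_inv ?c_rng_inv.
Qed.
Let c_mul_invl g : coarse_mul (coarse_inv g) g = coarse_idn (coarse_src g).
Proof.
by apply: coarse_arrow_eq;
  rewrite ?c_rng_mul ?c_src_mul ?c_rng_idn ?c_src_idn ?c_src_inv ?c_rng_inv.
Qed.

Let c_rng_continuous : continuous coarse_rng.
Proof.
move=> g; apply: (@continuous_comp coarse_arrow _ _ val (beta_map fst)).
   exact: val_set_continuous.
exact: beta_map_continuous.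
Qed.
Let c_src_continuous : continuous coarse_src.
Proof.
move=> g; apply: (@continuous_comp coarse_arrow _ _ val (beta_map snd)).
   exact: val_set_continuous.
exact: beta_map_continuous.
Qed.
Let c_idn_continuous : continuous coarse_idn.
Proof. by apply: set_type_continuous; exact: beta_map_continuous. Qed.
Let c_inv_continuous : continuous coarse_inv.
Proof.
apply: set_type_continuous => g.
apply: (@continuous_comp coarse_arrow _ _ val (beta_map (fun p => (p.2, p.1)))).
  exact: val_set_continuous.
exact: beta_map_continuous.
Qed.

Let nbhs_coarse g (A : set (X * X)) : val g A ->
  nbhs g [set h : coarse_arrow | val h A].
Proof.
move=> gA; apply/nbhs_set_type; exists [set w : beta (X * X) | w A] => //.
by apply/beta_nbhs; exists A.
Qed.

Let c_mul_continuous :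
  {within [set p : coarse_arrow * coarse_arrow | coarse_src p.1 = coarse_rng p.2],
    continuous (fun p => coarse_mul p.1 p.2)}.
Proof.
apply/subspace_continuousP => -[g h] /= gh U /nbhs_set_type[V].
move=> /beta_nbhs[E gE EV] VU.
have /coarse_arrowP[r r0 gr] := set_valP g.
have /coarse_arrowP[s s0 hs] := set_valP h.
have rs0 := addr_gt0 r0 s0.
have [B hB Bsep] := separated_set (coarse_src h) (addr_gt0 rs0 rs0).
pose C := [set p | [/\ E p, Delta (r + s) p & B p.2]].
have ghC : val (coarse_mul g h) C.
  have ghB : val (coarse_mul g h) (snd @^-1` B).
    suff : coarse_src (coarse_mul g h) B by [].
    by rewrite (c_src_mul gh).
  have := betaI gE (betaI (coarse_mul_Delta gr hs rs0 gh) ghB).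
  by apply: betaS => p [? [? ?]].
pose A1 := [set p | Delta r p /\ (fst @` C) p.1].
pose B1 := [set p : X * X | Delta s p /\ B p.2].
have gA1 : val g A1.
  have : coarse_rng g (fst @` C).
    by rewrite -(c_rng_mul gh); apply: betaS ghC => p Cp; exists p.
  by move=> gC; apply: betaS (betaI gr gC) => p [].
have hB1 : val h B1 by exact: betaS (betaI hs hB).
exists ([set g' : coarse_arrow | val g' A1], [set h' : coarse_arrow | val h' B1]).
  by split; exact: nbhs_coarse.
move=> [g' h'] /= [gA hB'] gh'; apply/VU/EV => /=.
have k1 : val (coarse_mul g' h') (Delta (r + s)).
  by apply: coarse_mul_Delta => //; [apply: betaS gA|apply: betaS hB'] => p [].
have k2 : val (coarse_mul g' h') (fst @^-1` (fst @` C)).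
  suff : coarse_rng (coarse_mul g' h') (fst @` C) by [].
  by rewrite (c_rng_mul gh'); apply: betaS gA => p [].
have k3 : val (coarse_mul g' h') (snd @^-1` B).
  suff : coarse_src (coarse_mul g' h') B by [].
  by rewrite (c_src_mul gh'); apply: betaS hB' => p [].
apply: betaS (betaI k1 (betaI k2 k3)) => -[x y] [/= Dxy [[[x' y'] [/= Exy Dxy' By']]]].
move=> /= xx' By; rewrite -xx' in Dxy *.
suff -> : y = y' by [].
apply: Bsep => //; rewrite (le_trans (metric_triangle _ x' _))// lerD//.
by rewrite metric_sym.
Qed.

Definition coarse_groupoid : topologicalGroupoid :=
  TopologicalGroupoid c_rng_idn c_src_idn c_rng_inv c_src_inv c_rng_mul c_src_mul
    c_mulA c_mul_idl c_mul_idr c_mul_invr c_mul_invl c_rng_continuous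
    c_src_continuous c_idn_continuous c_inv_continuous c_mul_continuous.

Definition boundary : set (beta X) := ~` range (@beta_eta X).

Definition boundary_groupoid : topologicalGroupoid :=
  @restriction coarse_groupoid boundary.

End CoarseGroupoid.

Arguments coarse_arrow {R} X.
Arguments boundary {R} X.

(** * The boundary groupoid is sigma-compact, etale, with compact unit space *)

Lemma set_type_hausdorff (T : topologicalType) (A : set T) :
  hausdorff_space T -> hausdorff_space A.
Proof.
move=> hT x y xy; apply/val_inj/hT => U V nU nV.
have [||z [Uz Vz]] := xy (val @^-1` U) (val @^-1` V).
- by apply/nbhs_set_type; exists U.
- by apply/nbhs_set_type; exists V.
- by exists (val z).
Qed.

Lemma set_type_compact (T : topologicalType) (A : set T) (K : set T) :
  K `<=` A -> compact K -> compact (val @^-1` K : set A).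
Proof.
move=> KA; rewrite !compact_ultra => cK F UF FK.
have [p [Kp Fp]] := cK _ (beta_ultra (beta_map val (Beta UF))) FK.
exists (mksub (KA _ Kp)); split => //= U /nbhs_set_type[V nV VU].
exact: (@filterS _ F _ _ _ VU (Fp _ nV)).
Qed.

Section BoundaryGroupoid.
Context {R : realType} (X : metricType R) (Xbg : bounded_geometry X).
Implicit Types g h : coarse_arrow X.

Lemma boundary_closed : closed (boundary X).
Proof.
apply: open_closedC; rewrite beta_openE => _ [x _ <-]; exists [set x].
  exact/beta_etaE.
by move=> v vx; rewrite (beta_eta_set1 vx); exists x.
Qed.

Lemma coarse_src_eta g (x : X) :
  coarse_rng g = beta_eta x -> range beta_eta (coarse_src g).
Proof.
move=> gx; have /coarse_arrowP[r r0 gr] := set_valP g.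
have [B gB Bsep] := separated_set Xbg (coarse_src g) (addr_gt0 r0 r0).
have gx1 : val g (fst @^-1` [set x]).
  suff : coarse_rng g [set x] by [].
  by rewrite gx; exact/beta_etaE.
have gC := betaI gr (betaI (gB : val g (snd @^-1` B)) gx1).
have [[x0 y] [Dy [/= By x0x]]] := beta_nonempty gC.
exists y => //; apply/esym/beta_eta_set1; apply: betaS gC => -[x1 z] [/= Dz [Bz x1x]].
apply: Bsep => //; rewrite (le_trans (metric_triangle _ x _))// lerD//.
  by rewrite metric_sym; move: Dz; rewrite x1x.
by move: Dy; rewrite x0x.
Qed.

Lemma boundary_saturated g : boundary X (coarse_rng g) <-> boundary X (coarse_src g).
Proof.
rewrite /boundary; split=> /= nb [x _ xE]; apply: nb; last exact: coarse_src_eta (esym xE).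
have rs : coarse_rng (coarse_inv g) = coarse_src g by exact: beta_eq.
have [y _ yE] := coarse_src_eta (etrans rs (esym xE)).
by exists y => //; rewrite yE; exact: beta_eq.
Qed.

Lemma boundary_arrowE g :
  restr_arrow (G := coarse_groupoid Xbg) (boundary X) g <-> boundary X (coarse_rng g).
Proof.
split=> [[]//|bg]; split=> //; exact/boundary_saturated.
Qed.

Lemma coarse_lift (E : set (X * X)) (u : beta X) : u (fst @` E) ->
  exists w : beta (X * X), w E /\ beta_map fst w = u.
Proof.
move=> uE.
pose Gs : set_system (X * X)%type := [set C | exists2 A, u A & C = [set p | E p /\ A p.1]].
have [] := @beta_ex _ Gs.
- by exists [set p | E p /\ [set: X] p.1], setT => //; exact: betaT.
- move=> _ [A uA ->]; have [_ [[p Ep <-] Ap]] := beta_nonempty (betaI uE uA).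
  by exists p.
- move=> _ _ [A uA ->] [B uB ->]; exists [set p | E p /\ (A `&` B) p.1].
    by exists (A `&` B) => //; exact: betaI.
  by move=> p [Ep [? ?]].
- move=> w Gw; exists w; split.
    have : w [set p | E p /\ [set: X] p.1] by apply: Gw; exists setT => //; exact: betaT.
    by apply: betaS => p [].
  apply/esym/beta_eq => A uA.
  have : w [set p | E p /\ A p.1] by apply: Gw; exists A.
  by apply: betaS => p [].
Qed.

Lemma coarse_groupoid_etale : etale (coarse_groupoid Xbg).
Proof.
move=> g; have /coarse_arrowP[r r0 gr] := set_valP g.
have [B gB Bsep] := separated_set Xbg (coarse_src g) (addr_gt0 r0 r0).
pose C : set (X * X) := [set p | Delta r p /\ B p.2].
have gC : val g C by exact: betaS (betaI gr (gB : val g (snd @^-1` B))).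
have oC : open [set h : coarse_arrow X | val h C].
  by exists [set w : beta (X * X) | w C] => //; exact: beta_open.
have Cinj p q : C p -> C q -> p.1 = q.1 -> p = q.
  case: p q => [x y] [x' y'] [Dxy /= By] [Dxy' /= By'] xx'; subst x'.
  congr pair; apply: Bsep => //.
  by rewrite (le_trans (metric_triangle _ x _))// lerD// metric_sym.
exists [set h : coarse_arrow X | val h C]; split=> //.
- move=> h k; rewrite !inE /= => hC kC hk; apply/val_inj/beta_eq => A hA.
  have kA : val k (fst @^-1` (fst @` (A `&` C))).
    suff : coarse_rng k (fst @` (A `&` C)) by [].
    rewrite -[coarse_rng k]hk; apply: betaS (betaI hA hC) => p ACp.
    by exists p.
  apply: betaS (betaI kC kA) => p [Cp [q [Aq Cq] qp]].
  by rewrite -(Cinj _ _ Cq Cp qp).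
- move=> V VC oV; rewrite beta_openE => _ [h Vh <-].
  have nV : nbhs h V by rewrite nbhsE; exists V.
  have /nbhs_set_type[W /beta_nbhs[A hA AW] WV] := nV.
  have hAC : val h (A `&` C) by apply: betaI => //; exact: (VC _ Vh).
  exists (fst @` (A `&` C)).
    by apply: betaS hAC => p ?; exists p.
  move=> v /coarse_lift[w [wAC wv]].
  have wc : coarse_arrow X w.
    by apply/coarse_arrowP; exists r => //; apply: betaS wAC => p [_ []].
  exists (mksub wc); last exact: wv.
  by apply: WV; apply: AW => /=; apply: betaS wAC => p [].
Qed.

Lemma coarse_compact (r : R) :
  0 < r -> compact [set g : coarse_arrow X | val g (Delta r)].
Proof.
move=> r0.
apply: (@set_type_compact _ (coarse_arrow X) [set w | beta_val w (Delta r)]).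
  by move=> w wr; apply/coarse_arrowP; exists r.
exact: (subclosed_compact (@beta_closed _ _) (@beta_compact _) (subsetT _)).
Qed.

Local Notation bA := (restr_arrow (G := coarse_groupoid Xbg) (boundary X)).

Lemma boundary_arrow_compact (r : R) : 0 < r ->
  compact [set g : bA | beta_val (val (val g)) (Delta r)].
Proof.
move=> r0.
pose K : set (coarse_arrow X) := [set g : coarse_arrow X | val g (Delta r)] `&` bA.
rewrite (_ : [set g | _] = (val @^-1` K : set bA)); last first.
  apply/seteqP; split=> g; last by case.
  by move=> gr; split => //; exact: set_valP.
apply: set_type_compact; first by move=> g [].
apply: (subclosed_compact _ (coarse_compact r0)); last by move=> g [].
rewrite (_ : K = [set g : coarse_arrow X | val g (Delta r)] `&`
                 (@coarse_rng _ X) @^-1` boundary X); last first.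
  by apply/seteqP; split => g [gr /boundary_arrowE gb].
apply: closedI.
  have /continuous_closedP cv := @val_set_continuous _ (coarse_arrow X).
  exact: (cv [set w : beta (X * X) | w (Delta r)] (@beta_closed _ _)).
have /continuous_closedP cr := @rng_continuous (coarse_groupoid Xbg).
exact: (cr _ boundary_closed).
Qed.

Lemma boundary_groupoid_sigma_compact_etale :
  [/\ compact [set: unit_space (boundary_groupoid Xbg)],
      hausdorff_space (unit_space (boundary_groupoid Xbg)),
      hausdorff_space (boundary_groupoid Xbg),
      locally_compact [set: boundary_groupoid Xbg] /\
      sigma_compact (boundary_groupoid Xbg) &
      etale (boundary_groupoid Xbg)].
Proof.
have hA : hausdorff_space (boundary_groupoid Xbg).
  by do 2!apply: set_type_hausdorff; exact: beta_hausdorff.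
split.
- have -> : [set: boundary X] = val @^-1` (boundary X).
    by apply/seteqP; split => // u _; exact: set_valP.
  apply: set_type_compact => //.
  exact: (subclosed_compact boundary_closed (@beta_compact _) (subsetT _)).
- by apply: set_type_hausdorff; exact: beta_hausdorff.
- exact: hA.
- split.
    move=> g _; have /coarse_arrowP[r r0 gr] := set_valP (val g).
    have cK := boundary_arrow_compact r0.
    rewrite withinET; exists [set h : bA | beta_val (val (val h)) (Delta r)].
      apply/nbhs_set_type; exists [set h : coarse_arrow X | val h (Delta r)] => //.
      apply/nbhs_set_type; exists [set w : beta (X * X) | w (Delta r)] => //.
      by apply/beta_nbhs; exists (Delta r).
    by split => //; exact: compact_closed.
  exists (fun n => [set g : bA | beta_val (val (val g)) (Delta n.+1%:R)]); split.
    by move=> n; exact: boundary_arrow_compact.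
  apply/seteqP; split => // g _; have /coarse_arrowP[r r0 gr] := set_valP (val g).
  exists (Num.truncn r) => //=; apply: betaS gr; apply: Delta_le.
  exact/ltW/truncnS_gt.
- move=> g; have [U [oU Ug Uinj Uopen]] := coarse_groupoid_etale (val g).
  exists (val @^-1` U); split=> //.
  + by exists U.
  + move=> h k; rewrite !inE /= => Uh Uk /(congr1 val)/= hk.
    by apply/val_inj/Uinj; rewrite ?inE.
  + move=> V VU [W oW WV].
    pose W' := W `&` U.
    exists (@rng (coarse_groupoid Xbg) @` W').
      by apply: Uopen; [move=> ? []|exact: openI].
    apply/seteqP; split.
      move=> u /= [h [Wh Uh] hu].
      have hb : restr_arrow (G := coarse_groupoid Xbg) (boundary X) h.
        by apply/boundary_arrowE; rewrite [coarse_rng h]hu; exact: set_valP.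
      exists (mksub hb); last exact: val_inj.
      by rewrite -WV.
    move=> _ [h Vh <-]; exists (val h) => //; split; last exact: VU.
    by move: Vh; rewrite -WV.
Qed.

End BoundaryGroupoid.

(* Main.v *)
Require Import Defs.
From mathcomp Require Import all_boot all_order all_algebra finmap.
From mathcomp Require Import all_classical all_reals all_analysis.
From mathcomp Require Import ring lra zify.

Set Implicit Arguments.
Unset Strict Implicit.
Unset Printing Implicit Defensive.

Import Order.TTheory GRing.Theory Num.Theory.
Import numFieldNormedType.Exports.

Local Open Scope classical_set_scope.
Local Open Scope ring_scope.

(** At each scale [n], off a bounded set, the fibred embedding maps every subset of diameter at most
    [n] to a Hilbert space, where squared distances are of negative type. Transition maps are
    isometries, so the distance between two images does not depend on the subset: this gives kernels
    [phi n] of negative type on small sets far out ([fibred_coarse_embedding_kernels]).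

    Kernels of different scales are unrelated and no single scale serves all arrows, so they are
    averaged: [average x y] is the mean of [phi n x y] over [n < N x]. Here [N] tends to infinity,
    changes by at most [r] over distance [r], and [n < N x] keeps [x] off the bounded set of scale
    [n] ([slow_proper_function]). Among points within [r] of each other, all but a multiple of [r]
    of the indices are good for all of them at once, and every term is at most [B r]. So symmetry,
    negative type and lower bounds pass to the average up to an error of order [r / N x]
    ([average_approx]).

    A boundary arrow is an ultrafilter on pairs at bounded distance along which [N] tends to
    infinity. In the limit [boundary_kernel] the errors vanish; continuity comes from the topology
    of ultrafilters, properness from the divergence of [rho1]. *)

(** * Kernels at each scale from a fibred coarse embedding *)

(** Expanding the squares, the diagonal terms die because the weights sum to zero; what remains is
    minus twice the squared norm of the weighted sum of the [v j]. *)
Lemma sqr_norm_negative_type (R : realType) (H : hilbertSpace R) (n : nat)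
    (v : 'I_n -> H) (sigma : 'I_n -> R) : \sum_j sigma j = 0 ->
  \sum_j \sum_k sigma j * sigma k * `|v j - v k| ^+ 2 <= 0.
Proof.
move=> s0; set f := inner H.
have fC a b : f a b = f b a by have := hermC f a b; rewrite expr0 mul1r.
have nE a b : `|a - b| ^+ 2 = f a a + f b b - 2 * f a b.
  by rewrite -inner_norm -/f linearBl !linearBr /= (fC b a); ring.
pose w := \sum_j sigma j *: v j.
have wE : f w w = \sum_j \sum_k sigma j * sigma k * f (v j) (v k).
  rewrite [in LHS]/w linear_sumlz; apply: eq_bigr => j _.
  rewrite linearZl_LR linear_sumr /= mulr_sumr; apply: eq_bigr => k _.
  by rewrite linearZr_LR /= mulrA.
have s1 : \sum_j \sum_k sigma j * sigma k * f (v j) (v j) = 0.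
  under eq_bigr => j _ do rewrite -mulr_suml -mulr_sumr s0 mulr0 mul0r.
  by rewrite big1.
have s2 : \sum_j \sum_k sigma j * sigma k * f (v k) (v k) = 0.
  rewrite exchange_big/=.
  under eq_bigr => j _ do rewrite -mulr_suml -mulr_suml s0 !mul0r.
  by rewrite big1.
have -> : \sum_j \sum_k sigma j * sigma k * `|v j - v k| ^+ 2 = - (2 * f w w).
  transitivity (0 + 0 - 2 * f w w); last by rewrite !add0r.
  rewrite -[X in X + _ - _]s1 -[X in _ + X - _]s2 wE mulr_sumr -big_split -sumrB.
  apply: eq_bigr => j _; rewrite /= mulr_sumr -big_split -sumrB.
  by apply: eq_bigr => k _; rewrite /= nE; ring.
by rewrite oppr_le0 inner_norm mulr_ge0// sqr_ge0.
Qed.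

(** Enclose [K n] in the ball of radius [b n] about [x0], and let every ball, once born at time [n],
    grow at unit speed; [f x] is the first time at which [x] is covered. *)
Lemma slow_proper_function (R : realType) (X : metricType R)
    (K : nat -> set X) : (forall n, metric_bounded (K n)) ->
  exists f : X -> nat,
  [/\ forall x y r, mdist x y <= r%:R -> (f x <= f y + r)%N,
      forall n x, K n x -> (f x <= n)%N &
      forall n, exists M : R, forall x y,
        (f x <= n)%N -> (f y <= n)%N -> mdist x y <= M].
Proof.
move=> bK.
have [[x0 _]|X0] := pselect ([set: X] !=set0); last first.
  exists (fun=> 0%N); split=> // n; exists 0 => x; case: X0; by exists x.
have /choice[b bP] : forall n, exists M : R, 0 <= M /\
    forall x, K n x -> mdist x0 x <= M.
  move=> n; have [M MP] := bK n.
  have [[y Ky]|nK] := pselect (K n !=set0); last first.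
    by exists 0; split => // x Kx; case: nK; exists x.
  exists (mdist x0 y + `|M|); split; first by rewrite addr_ge0// mdist_ge0.
  move=> x Kx; rewrite (le_trans (metric_triangle _ y _))// lerD//.
  by rewrite (le_trans (MP y x Ky Kx))// ler_norm.
pose P x m := `[< exists2 n, (n <= m)%N & mdist x0 x <= b n + (m - n)%:R >].
have exP x : exists m, P x m.
  exists (Num.truncn (mdist x0 x)).+1; apply/asboolP; exists 0%N => //.
  rewrite subn0 (le_trans (ltW (truncnS_gt _)))// lerDr.
  exact: (bP 0%N).1.
exists (fun x => ex_minn (exP x)); split.
- move=> x y r xy; case: ex_minnP => m _ mmin.
  case: ex_minnP => k /asboolP[n nk yk] _.
  apply: mmin; apply/asboolP; exists n; first by rewrite (leq_trans nk)// leq_addr.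
  rewrite -addnC -addnBA// addnC natrD addrA.
  by rewrite (le_trans (metric_triangle _ y _))// lerD// metric_sym.
- move=> n x Kx; case: ex_minnP => m _; apply; apply/asboolP; exists n => //.
  by rewrite subnn addr0; exact: (bP n).2.
- move=> n; pose M := \sum_(i < n.+1) b i + n%:R.
  suff H x : (ex_minn (exP x) <= n)%N -> mdist x0 x <= M.
    exists (M + M) => x y /H x0x /H x0y.
    by rewrite (le_trans (metric_triangle _ x0 _))// lerD// metric_sym.
  case: ex_minnP => m /asboolP[k km xk] _ mn.
  rewrite (le_trans xk)// lerD//; last by rewrite ler_nat (leq_trans (leq_subr _ _)).
  have kn : (k < n.+1)%N by rewrite ltnS (leq_trans km).
  rewrite (bigD1 (Ordinal kn))//= lerDl sumr_ge0// => i _; exact: (bP i).1.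
Qed.

(** All that averaging needs. The bound [B r] and the threshold [r0] must not depend on [n], since
    they have to survive a mean over ever more scales. *)
Record local_kernels (R : realType) (X : metricType R)
    (phi : nat -> X -> X -> R) (N : X -> nat) (B : nat -> R) : Prop := {
  slow : forall x y r, mdist x y <= r%:R -> (N x <= N y + r)%N;
  slow_proper : forall n, exists M : R, forall x x', 
    (N x <= n)%N -> (N x' <= n)%N -> mdist x x' <= M;
  kernel_ge0 : forall n x y, 0 <= phi n x y;
  kernel_le : forall n x y r, mdist x y <= r%:R -> phi n x y <= B r;
  kernel_diag : forall n x, phi n x x = 0;
  kernel_sym : forall n x y, phi n x y = phi n y x;
  kernel_negative_type : forall n m (y : 'I_m -> X) (sigma : 'I_m -> R),
    (forall j k, mdist (y j) (y k) <= n%:R) -> (forall j, (n < N (y j))%N) ->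
    \sum_j sigma j = 0 ->
    \sum_j \sum_k sigma j * sigma k * phi n (y j) (y k) <= 0;
  kernel_ge : forall M : R, exists r0 : R, forall n x y,
    r0 < mdist x y <= n%:R -> (n < N x)%N -> (n < N y)%N -> M <= phi n x y
}.

Lemma diameter_lt (R : realType) (X : metricType R) (C : set X) (r r' : R) :
  r < r' -> (forall x y, C x -> C y -> mdist x y <= r) -> (diameter C < r'%:E)%E.
Proof.
move=> rr' Cr; apply: (@le_lt_trans _ _ r%:E); last by rewrite lte_fin.
by apply: ge_ereal_sup => _ [[x y] [/= Cx Cy] <-]; rewrite lee_fin Cr.
Qed.

Lemma fibred_coarse_embedding_kernels (R : realType) (X : metricType R) :
  fibred_coarse_embedding X -> exists phi N B, @local_kernels R X phi N B.
Proof.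
move=> [E [s [rho1 [rho2 [H [rho1P rho2P rho1oo rho2oo fce]]]]]].
(* Scale [n.+1] is positive even for [n = 0], and its strict bound on diameters admits all distances
   up to [n]. *)
have /choice[Kt KtP] : forall n : nat, exists Kt : set X * (set X -> forall x, E x -> H),
    let small C := C `<=` ~` Kt.1 /\ (diameter C < n.+1%:R%:E)%E in
      [/\ metric_bounded Kt.1,
          forall C x, small C -> C x -> affine_isometry (Kt.2 C x),
          forall C x y, small C -> C x -> C y ->
            rho1 (mdist x y) <= `|Kt.2 C x (s x) - Kt.2 C y (s y)| <= rho2 (mdist x y) &
          forall C1 C2, small C1 -> small C2 -> C1 `&` C2 !=set0 ->
            exists2 T : H -> H, affine_isometry T &
              forall x, (C1 `&` C2) x -> Kt.2 C1 x = T \o Kt.2 C2 x].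
  by move=> n; have [K [t Kt]] := fce n.+1%:R (ltr0Sn _ _); exists (K, t).
pose small n C := C `<=` ~` (Kt n).1 /\ (diameter C < n.+1%:R%:E)%E.
have [n|N [Nslow NK Nproper]] := @slow_proper_function _ _ (fun n => (Kt n).1).
  by have [] := KtP n.
pose v n C x := (Kt n).2 C x (s x).
pose good n x y := [&& mdist x y <= n%:R, (n < N x)%N & (n < N y)%N].
(* The trivialisation over the pair itself makes this symmetric; the value zero elsewhere makes the
   upper bound, symmetry and vanishing on the diagonal unconditional. *)
pose phi n x y := if good n x y then `|v n [set x; y] x - v n [set x; y] y| ^+ 2 else 0.
have goodC n x y : good n x y = good n y x by rewrite /good metric_sym [X in _ && X]andbC.
have smallP n C : (forall x y, C x -> C y -> mdist x y <= n%:R) ->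
    (forall x, C x -> (n < N x)%N) -> small n C.
  move=> dC CN; split; last by apply: diameter_lt dC; rewrite ltr_nat.
  by move=> x /CN nx /NK; rewrite leqNgt nx.
have small2 n x y : good n x y -> small n [set x; y].
  move=> /and3P[xy nx ny]; apply: smallP; last by move=> _ [] ->.
  by move=> _ _ [] -> [] ->; rewrite ?mdistxx ?ler0n// metric_sym.
have phiE n C x y : small n C -> C x -> C y -> good n x y ->
    phi n x y = `|v n C x - v n C y| ^+ 2.
  move=> sC Cx Cy xy; rewrite /phi xy.
  have [_ _ _ tC] := KtP n.
  have [|T [_ Tiso _] TE] := tC _ _ (small2 _ _ _ xy) sC.
    by exists x; split => //; left.
  by rewrite /v (TE x) ?(TE y) /= ?Tiso//; split=> //; [right|left].
have phi_bound n x y : good n x y ->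
    exists a, [/\ phi n x y = a ^+ 2, 0 <= a & rho1 (mdist x y) <= a <= rho2 (mdist x y)].
  move=> xy; rewrite /phi xy; eexists; split; [reflexivity|by []|].
  have [_ _ H3 _] := KtP n; apply: H3; [exact: small2|by left|by right].
exists phi, N, (fun r => `|rho2 r%:R| ^+ 2); split => //.
- by move=> n x y; rewrite /phi; case: ifP => // _; exact: sqr_ge0.
- move=> n x y r xyr; have [xy|/negPf xy] := boolP (good n x y); last first.
    by rewrite /phi xy sqr_ge0.
  have [a [-> a0 /andP[_ ar]]] := phi_bound _ _ _ xy.
  rewrite lerXn2r ?nnegrE// (le_trans ar)// (le_trans _ (ler_norm _))//.
  by apply: rho2P; rewrite ?in_itv/= ?andbT ?mdist_ge0// ler0n.
- by move=> n x; rewrite /phi; case: ifP => // _; rewrite subrr normr0 expr0n.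
- by move=> n x y; rewrite /phi goodC setUC distrC.
- move=> n m y sigma yn yN s0; have sC : small n (range y).
    by apply: smallP; [move=> _ _ [j _ <-] [k _ <-]|move=> _ [j _ <-]].
  have phijk j k : phi n (y j) (y k) = `|v n (range y) (y j) - v n (range y) (y k)| ^+ 2.
    by apply: phiE; rewrite ?/good ?yn ?yN.
  under eq_bigr => j _ do under eq_bigr => k _ do rewrite phijk.
  exact: sqr_norm_negative_type.
(* The bound 1 is there so that [a <= a ^+ 2], whence [M <= a] suffices. *)
- move=> M; move/cvgryPge: rho1oo => /(_ (Num.max 1 M))[r0 [_ r0P]].
  exists r0 => n x y /andP[r0xy xyn] nx ny.
  have [|a [-> a0 /andP[ra _]]] := @phi_bound n x y; first by rewrite /good xyn nx ny.
  have := le_trans (r0P _ r0xy) ra; rewrite ge_max => /andP[a1 aM].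
  by rewrite (le_trans aM)// expr2 ler_peMr.
Qed.

(** * Averaging over scales, with explicit errors *)

Section Average.
Context {R : realType} {X : metricType R}.
Variables (phi : nat -> X -> X -> R) (N : X -> nat) (B : nat -> R).

(** The number of scales depends on the first point, so symmetry is only asymptotic. The value is 0
    when [N x] is 0. *)
Definition average (x y : X) : R := (\sum_(0 <= n < N x) phi n x y) / (N x)%:R.

Hypothesis K : local_kernels phi N B.

Let sum_ge0 a b x y : 0 <= \sum_(a <= n < b) phi n x y.
Proof. by rewrite sumr_ge0// => n _; exact: kernel_ge0 K _ _ _. Qed.

Let sum_le a b x y r : mdist x y <= r%:R ->
  \sum_(a <= n < b) phi n x y <= (b - a)%:R * B r.
Proof.
move=> xy; rewrite -[b in leRHS]/b mulr_natl -sumr_const_nat.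
by apply: ler_sum => n _; exact: kernel_le K _ _ _ _ _.
Qed.

Let averageK x y : (N x)%:R * average x y = \sum_(0 <= n < N x) phi n x y.
Proof.
rewrite /average mulrC; have [->|n0] := eqVneq (N x) 0%N; first by rewrite mulr0 big_geq.
by rewrite divfK// pnatr_eq0.
Qed.

Lemma average_ge0 x y : 0 <= average x y.
Proof. by rewrite divr_ge0. Qed.

Lemma average_le x y r : mdist x y <= r%:R -> average x y <= B r.
Proof.
move=> xy; have B0 : 0 <= B r := le_trans (kernel_ge0 K 0 x y) (kernel_le K 0 xy).
rewrite /average; have [->|n0] := posnP (N x); first by rewrite invr0 mulr0.
by rewrite ler_pdivrMr ?ltr0n// mulrC (le_trans (sum_le _ _ xy))// subn0.
Qed.

Lemma average_diag x : average x x = 0.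
Proof. by rewrite /average big1 ?mul0r// => n _; exact: kernel_diag K _ _. Qed.

                                                                   
(** The window from [r] to [N p - r] is common to all points near [p]. Replacing [N x] by [N p]
    costs [r * B r], the terms below the window [r * B r], and those above it at most [2 * r * B r],
    as [N x <= N p + r]. *)
Lemma average_approx p x y r : (r + r <= N p)%N ->
  mdist x p <= r%:R -> mdist x y <= r%:R ->
  `|(N p)%:R * average x y - \sum_(r <= n < N p - r) phi n x y| <= (4 * r)%:R * B r.
Proof.
move=> Np xp xy.
have Nxp := slow K xp; have Npx : (N p <= N x + r)%N by apply: (slow K); rewrite metric_sym.
have -> : (N p)%:R * average x y - \sum_(r <= n < N p - r) phi n x y =
    ((N p)%:R - (N x)%:R) * average x y +
    (\sum_(0 <= n < r) phi n x y + \sum_(N p - r <= n < N x) phi n x y).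
  rewrite mulrBl averageK (@big_cat_nat _ _ _ r 0 (N x))//=; last by lia.
  by rewrite (@big_cat_nat _ _ _ (N p - r) r (N x))//=; [ring|lia|lia].
rewrite (le_trans (ler_normD _ _))// normrM (ger0_norm (average_ge0 _ _)).
rewrite [X in _ + X]ger0_norm ?addr_ge0//.
have -> : (4 * r)%:R * B r = r%:R * B r + ((r - 0)%:R * B r + (r + r)%:R * B r).
  by rewrite subn0 natrM natrD; ring.
have B0 : 0 <= B r := le_trans (kernel_ge0 K 0 x y) (kernel_le K 0 xy).
have dN : `|(N p)%:R - (N x)%:R| <= r%:R :> R.
  by rewrite ler_distl lerBlDr -!natrD !ler_nat Npx Nxp.
apply: lerD; first by apply: ler_pM => //; [exact: average_ge0|exact: average_le].
apply: lerD; first exact: sum_le.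
rewrite (le_trans (sum_le _ _ xy))// ler_wpM2r// ler_nat; lia.
Qed.

(** Both averages are compared with the same window sum based at [x], which is symmetric; the two
    errors add up to 8. *)
Lemma average_sym x y r : (r + r <= N x)%N -> mdist x y <= r%:R ->
  (N x)%:R * `|average x y - average y x| <= (8 * r)%:R * B r.
Proof.
move=> Nx xy; have yx : mdist y x <= r%:R by rewrite metric_sym.
have x0 : mdist x x <= r%:R by rewrite mdistxx.
have := average_approx Nx x0 xy; have := average_approx Nx yx yx.
under eq_bigr do rewrite (kernel_sym K); move=> H1 H2.
rewrite -[(N x)%:R]normr_nat -normrM.
rewrite (_ : (8 * r)%:R = (4 * r)%:R + (4 * r)%:R :> R); last by rewrite -natrD; congr _%:R; lia.
rewrite mulrDl; apply: le_trans (lerD H2 H1); apply: le_trans (ler_normB _ _).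
by rewrite opprB addrA subrK mulrBr.
Qed.

(** For [r <= n < N x - r] the scale exceeds the distance and [n < N y], so only [r + r] terms can
    fail the bound, and these are nonnegative. *)
Lemma average_ge x y r M : 0 <= M -> mdist x y <= r%:R ->
  (forall n, mdist x y <= n%:R -> (n < N x)%N -> (n < N y)%N -> M <= phi n x y) ->
  (N x)%:R * M - (r + r)%:R * M <= (N x)%:R * average x y.
Proof.
move=> M0 xy phiM; rewrite averageK -mulrBl.
have Nxy := slow K xy.
have [Nx|Nx] := leqP (r + r) (N x); last first.
  by rewrite (le_trans _ (sum_ge0 _ _ _ _))// mulr_le0_ge0// subr_le0 ler_nat ltnW.
rewrite (@big_cat_nat _ _ _ r 0 (N x))//=; last by lia.
rewrite (@big_cat_nat _ _ _ (N x - r) r (N x))//=; [|lia|lia].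
rewrite addrA addrAC -[leLHS]add0r lerD// ?addr_ge0//.
rewrite -natrB// subnDA mulr_natl -sumr_const_nat.
apply: ler_sum_nat => n /andP[rn nx]; apply: phiM; [|lia|lia].
by rewrite (le_trans xy)// ler_nat.
Qed.

(** On the window based at [y ord0] each [phi n] is of negative type on the whole family; the
    right-hand side collects the errors of [average_approx]. *)
Lemma average_negative_type m (y : 'I_m.+1 -> X) (sigma : 'I_m.+1 -> R) r :
  (r + r <= N (y ord0))%N -> (forall j k, mdist (y j) (y k) <= r%:R) ->
  \sum_j sigma j = 0 ->
  (N (y ord0))%:R * \sum_j \sum_k sigma j * sigma k * average (y j) (y k) <=
  \sum_j \sum_k `|sigma j * sigma k| * ((4 * r)%:R * B r).
Proof.
move=> Np yr s0; set p := y ord0.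
pose S j k := \sum_(r <= n < N p - r) phi n (y j) (y k).
have S0 : \sum_j \sum_k sigma j * sigma k * S j k <= 0.
  rewrite (_ : \sum_j _ = \sum_(r <= n < N p - r) \sum_j \sum_k
      sigma j * sigma k * phi n (y j) (y k)).
    rewrite big_nat sumr_le0// => n /andP[rn np]; apply: (kernel_negative_type K) => //.
      by move=> j k; rewrite (le_trans (yr j k))// ler_nat.
    move=> j; have := slow K (yr ord0 j); rewrite -/p; lia.
  rewrite [RHS]exchange_big; apply: eq_bigr => j _.
  rewrite [RHS]exchange_big; apply: eq_bigr => k _.
  by rewrite mulr_sumr.
rewrite -[leRHS]addr0; apply: le_trans (lerD (lexx _) S0).
rewrite mulr_sumr -big_split; apply: ler_sum => j _.
rewrite mulr_sumr -big_split; apply: ler_sum => k _ /=.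
rewrite mulrCA -lerBlDr -mulrBr (le_trans (ler_norm _))// normrM ler_wpM2l//.
by apply: average_approx => //; exact: yr.
Qed.

End Average.

(** * Limits along ultrafilters and joint lifts *)

Definition beta_filter (T : Type) (w : beta T) : set_system T := beta_val w.

#[local] Instance beta_filter_proper (T : Type) (w : beta T) :
  ProperFilter (beta_filter w).
Proof. exact: (@ultra_proper _ _ (beta_ultra w)). Qed.

Lemma beta_cvg (R : realType) (T : Type) (w : beta T) (f : T -> R) (a b : R) :
  w [set t | a <= f t <= b] -> cvg (f @ beta_filter w).
Proof.
move=> wab; have := @segment_compact R a b; rewrite compact_ultra.
move=> /(_ _ (beta_ultra (beta_map f w)))[|l [_ wl]]; last by apply/cvg_ex; exists l.
by apply: betaS wab => t; rewrite /= in_itv.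
Qed.

Lemma beta_joint_lift (X Y : Type) (m : nat) (g : 'I_m -> beta (X * Y)) (u : beta X) :
  (forall j, beta_map fst (g j) = u) ->
  exists w : beta ('I_m -> Y), forall (A : 'I_m -> set (X * Y)), (forall j, g j (A j)) ->
    w [set y | exists x, forall j, A j (x, y j)].
Proof.
move=> gu; pose S (A : 'I_m -> set (X * Y)) := [set y | exists x, forall j, A j (x, y j)].
have [] := @beta_ex _ [set C | exists2 A, (forall j, g j (A j)) & C = S A].
- by exists (S (fun=> setT)), (fun=> setT) => // j; exact: betaT.
- move=> _ [A gA ->].
  have uA : u [set x | forall j, (fst @` A j) x].
    apply: (@filter_forall _ 'I_m (fun j => fst @` A j) (beta_val u) _) => j.
    by rewrite -(gu j); apply: betaS (gA j) => p Ap; exists p.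
  have [x Ax] := beta_nonempty uA.
  have /choice[y Ay] : forall j, exists y, A j (x, y).
    by move=> j; have [[x' y] Ay /= <-] := Ax j; exists y.
  by exists y, x.
- move=> _ _ [A gA ->] [A' gA' ->]; exists (S (fun j => A j `&` A' j)).
    by exists (fun j => A j `&` A' j) => // j; exact: betaI.
  by move=> y [x AA]; split; exists x => j; have [] := AA j.
by move=> w Sw; exists w => A gA; apply: Sw; exists A.
Qed.

(** * The limit kernel on the boundary groupoid *)

Section BoundaryKernel.
Context {R : realType} {X : metricType R} (Xbg : bounded_geometry X).

(** By bounded geometry a bounded set is finite, and a nonprincipal ultrafilter contains no finite
    set. *)
Lemma boundary_bounded (u : beta X) (A : set X) :
  boundary X u -> metric_bounded A -> ~ u A.
Proof.
move=> bu [M AM] uA; have [x Ax] := beta_nonempty uA.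
have r0 : 0 < M + 1 by rewrite ltr_wpDl// (le_trans _ (AM x x Ax Ax))// mdist_ge0.
have [k kP] := Xbg r0; have [/finite_fsetP[D DE] _] := kP x.
have uD : u [set` D].
  apply: betaS uA => y Ay; rewrite -DE ballEmdist /=.
  by rewrite (le_lt_trans (AM x y Ax Ay))// ltrDl.
have : u (\bigcap_(y in [set` D]) ~` [set y]).
  apply: filter_bigI => y _; have [uy|//] := beta_dec u [set y].
  by case: bu; exists y => //; rewrite (beta_eta_set1 uy).
by move=> /(betaI uD)/beta_nonempty[y [Dy /(_ y Dy)]]; apply.
Qed.

Definition arrow_filter (g : boundary_groupoid Xbg) : beta (X * X) :=
  \val (\val (g : restr_arrow (G := coarse_groupoid Xbg) (boundary X))).

Definition unit_filter (u : unit_space (boundary_groupoid Xbg)) : beta X :=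
  \val (u : boundary X).

Lemma unit_filter_boundary u : boundary X (unit_filter u).
Proof. exact: set_valP. Qed.

Lemma arrow_filter_Delta g : exists r : nat, arrow_filter g (Delta r%:R).
Proof.
have /coarse_arrowP[r r0 gr] := set_valP (\val (g : restr_arrow _)).
exists (Num.truncn r).+1; apply: betaS gr; apply: Delta_le.
exact/ltW/truncnS_gt.
Qed.

Lemma arrow_filter_rng (g : boundary_groupoid Xbg) (A : set X) :
  unit_filter (rng g) A -> arrow_filter g (fst @^-1` A).
Proof. by []. Qed.

(** Products of arrows are defined by choice, so they are recognised through their range and source
    only. *)
Lemma arrow_filter_inj (g : boundary_groupoid Xbg) (w : beta (X * X)) (r : R) : w (Delta r) ->
  beta_map fst w = unit_filter (rng g) -> beta_map snd w = unit_filter (src g) ->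
  w = arrow_filter g.
Proof.
move=> wr w1 w2; have [s gs] := arrow_filter_Delta g.
apply: (@beta_pair_eq _ _ Xbg (Num.max r s%:R)) => //.
- by apply: betaS wr; apply: Delta_le; rewrite le_max lexx.
- by apply: betaS gs; apply: Delta_le; rewrite le_max lexx orbT.
Qed.

Lemma nbhs_arrow_filter (g : boundary_groupoid Xbg) (A : set (X * X)) : arrow_filter g A ->
  nbhs g [set h | arrow_filter h A].
Proof.
move=> gA; apply/nbhs_set_type.
exists [set h : coarse_arrow X | \val h A] => //.
apply/nbhs_set_type; exists [set w : beta (X * X) | w A] => //.
by apply/beta_nbhs; exists A.
Qed.

Variables (phi : nat -> X -> X -> R) (N : X -> nat) (B : nat -> R).
Hypothesis K : local_kernels phi N B.

Lemma slow_boundary (u : beta X) n : boundary X u -> u [set x | (n < N x)%N].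
Proof.
move=> bu; have [uN|] := beta_dec u [set x | (N x <= n)%N]; last first.
  by apply: betaS => x /= /negP; rewrite -ltnNge.
have [M MP] := slow_proper K n.
by case: (boundary_bounded bu _ uN); exists M => x y; exact: MP.
Qed.

Let avg (p : X * X) := average phi N p.1 p.2.

(** The Stone-Cech extension of the average, evaluated at a boundary arrow. *)
Definition boundary_kernel g : R := lim (avg @ beta_filter (arrow_filter g)).

Lemma boundary_kernel_cvg g : avg @ beta_filter (arrow_filter g) --> boundary_kernel g.
Proof.
have [r gr] := arrow_filter_Delta g; apply: (@beta_cvg _ _ _ _ 0 (B r)).
by apply: betaS gr => p pr /=; rewrite (average_ge0 K) (average_le K).
Qed.

Lemma boundary_kernel_ge g a : arrow_filter g [set p | a <= avg p] -> a <= boundary_kernel g.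
Proof. exact: cvgr_to_ge (@boundary_kernel_cvg g). Qed.

Lemma boundary_kernel_le g a : arrow_filter g [set p | avg p <= a] -> boundary_kernel g <= a.
Proof. exact: cvgr_to_le (@boundary_kernel_cvg g). Qed.

Lemma boundary_kernel_continuous : continuous boundary_kernel.
Proof.
move=> g; have FF : Filter (nbhs g) := @nbhs_filter _ g.
apply/(@cvgrPdist_le _ _ _ _ FF) => e e0.
(* This set of pairs belongs to [g], hence to every arrow of a basic neighbourhood of [g]. *)
have ge : arrow_filter g [set p | `|boundary_kernel g - avg p| <= e].
  by move/cvgrPdist_le: (@boundary_kernel_cvg g); apply.
apply: (@filterS _ (nbhs g) _ _ _ _ (nbhs_arrow_filter ge)) => h /= he.
rewrite ler_distlC; apply/andP; split.
  by apply: boundary_kernel_ge; apply: betaS he => p /=; rewrite ler_distlC => /andP[].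
by apply: boundary_kernel_le; apply: betaS he => p /=; rewrite ler_distlC => /andP[].
Qed.

Let small_quotient (u : beta X) (a e : R) : boundary X u -> 0 < e ->
  u [set x | a <= (N x)%:R * e].
Proof.
move=> bu e0; apply: betaS (slow_boundary (Num.truncn (a / e)) bu) => x /= nx.
rewrite -ler_pdivrMr// (le_trans (ltW (truncnS_gt _)))// ler_nat.
exact: nx.
Qed.

(** The preimage is closed, and it lies in the compact set of arrows containing [Delta r1]: on any
    other arrow the distance exceeds [r0] and the kernel is at least [L], beyond all of [C]. *)
Lemma boundary_kernel_proper : proper_map boundary_kernel.
Proof.
move=> C cC; have [M [_ MC]] := compact_bounded cC.
pose L := Num.max 0 (M + 1) + 1.
have L0 : 0 < L by rewrite ltr_wpDl// le_max lexx.
have CL a : C a -> a < L.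
  move=> Ca; rewrite (le_lt_trans (ler_norm _))// (@le_lt_trans _ _ (M + 1))//.
    by apply: MC => //; rewrite ltrDl.
  by rewrite /L (@le_lt_trans _ _ (Num.max 0 (M + 1)))// ?le_max ?lexx ?orbT// ltrDl.
(* The extra 1 absorbs the loss [(r + r) * (L + 1) / N x] of [average_ge]. *)
have [r0 r0P] := kernel_ge K (L + 1).
pose r1 := Num.max r0 1.
have r10 : 0 < r1 by rewrite lt_max ltr01 orbT.
apply: (@subclosed_compact (boundary_groupoid Xbg) _ [set g | arrow_filter g (Delta r1)]).
  move/continuous_closedP: boundary_kernel_continuous; apply.
  exact: compact_closed.
  exact: boundary_arrow_compact.
move=> g /= Cg; have [//|gn] := beta_dec (arrow_filter g) (Delta r1).
suff : L <= boundary_kernel g by rewrite leNgt CL.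
have [r gr] := arrow_filter_Delta g.
have gN : arrow_filter g [set p | (r + r)%:R * (L + 1) <= (N p.1)%:R * 1].
  exact: arrow_filter_rng (small_quotient _ (@unit_filter_boundary (rng g)) ltr01).
have gN0 : arrow_filter g [set p | (0 < N p.1)%N] 
  := arrow_filter_rng (slow_boundary 0 (@unit_filter_boundary (rng g))).
apply: boundary_kernel_ge; apply: betaS (betaI (betaI gr gn) (betaI gN gN0)).
move=> [x y] [/= [xyr /negP]]; rewrite /Delta/= -ltNge => r1xy [xN N0].
have L10 : 0 <= L + 1 by rewrite addr_ge0// ltW.
have r0xy : r0 < mdist x y by rewrite (le_lt_trans _ r1xy)// le_max lexx.
have xyL := average_ge K L10 xyr (fun n xyn => r0P n x y (introT andP (conj r0xy xyn))).
rewrite -(@ler_pM2l _ (N x)%:R) ?ltr0n//; apply: le_trans xyL.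
move: xN; rewrite mulr1 => xN; lra.
Qed.

Lemma boundary_kernel_idn u : boundary_kernel (idn u) = 0.
Proof.
apply: le_anti; apply/andP; split.
  apply: boundary_kernel_le; apply: (betaS _ (betaT (unit_filter u))) => x _.
  by rewrite /avg /= (average_diag K).
by apply: boundary_kernel_ge; apply: (betaS _ (betaT (unit_filter u))) => x _;
  rewrite /avg /= (average_diag K).
Qed.

Lemma boundary_kernel_inv g : boundary_kernel g = boundary_kernel (Defs.inv g).
Proof.
have [r gr] := arrow_filter_Delta g.
have gi : avg (p.2, p.1) @[p --> beta_filter (arrow_filter g)] --> boundary_kernel (Defs.inv g).
  exact: (@boundary_kernel_cvg (Defs.inv g)).
apply/subr0_eq/normr0_eq0/le_anti; rewrite normr_ge0 andbT.
apply/ler_addgt0Pr => e e0; rewrite add0r.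
have gB : `|avg p - avg (p.2, p.1)| @[p --> beta_filter (arrow_filter g)] -->
    `|boundary_kernel g - boundary_kernel (Defs.inv g)|.
  by apply: cvg_norm; apply: cvgB gi; exact: (@boundary_kernel_cvg g).
apply: (cvgr_to_le gB).
have gN : arrow_filter g [set p | (8 * r)%:R * B r <= (N p.1)%:R * e].
  exact: arrow_filter_rng (small_quotient _ (@unit_filter_boundary (rng g)) e0).
have gN0 : arrow_filter g [set p | (r + r < N p.1)%N] 
  := arrow_filter_rng (slow_boundary _ (@unit_filter_boundary (rng g))).
apply: betaS (betaI gr (betaI gN gN0)) => -[x y] [/= xyr [xN N0]].
rewrite -(@ler_pM2l _ (N x)%:R) ?ltr0n ?(leq_ltn_trans _ N0)//.
exact: le_trans (average_sym K (ltnW N0) xyr) xN.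
Qed.

(** All arrows are realised by one ultrafilter [w] on tuples [y] of their sources; its image under
    [(y j, y k)] is the product of the inverse of [g j] with [g k]. The finite inequality then
    passes to the limit along [w]. *)
Lemma boundary_kernel_negative_type m (g : 'I_m -> boundary_groupoid Xbg)
    (sigma : 'I_m -> R) :
  (forall j k, rng (g j) = rng (g k)) -> \sum_j sigma j = 0 ->
  \sum_j \sum_k sigma j * sigma k * boundary_kernel (Defs.mul (Defs.inv (g j)) (g k)) <= 0.
Proof.
case: m g sigma => [|m] g sigma grng s0; first by rewrite big_ord0.
have [|w wP] := @beta_joint_lift _ _ _ (fun j => arrow_filter (g j)) (unit_filter (rng (g ord0))).
  by move=> j; rewrite (grng ord0 j).
have /choice[q qP] := fun j => arrow_filter_Delta (g j).
(* Doubling makes [r] dominate [q j + q k] even for [j = k]. *)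
pose r := (\sum_j (q j + q j))%N.
have wr : w [set y | forall j k, mdist (y j) (y k) <= r%:R].
  apply: betaS (wP _ qP) => y [x xy] j k.
  rewrite (le_trans (metric_triangle _ x _))// metric_sym.
  have jx := xy j; have kx := xy k.
  have qr i : (q i + q i <= r)%N by rewrite /r (bigD1 i)//= leq_addr.
  rewrite /Delta /= in jx kx; rewrite (le_trans (lerD jx kx))// -natrD ler_nat.
  have := qr j; have := qr k; lia.
have wsrc j : beta_map (fun y => y j) w = unit_filter (src (g j)).
  apply/esym/beta_eq => A gA.
  (* Constraining only the [j]-th arrow reads off the [j]-th source. *)
  have gAj i : arrow_filter (g i) (if i == j then [set p | A p.2] else setT).
    by case: eqP => [->|_] //; exact: betaT.
  by apply: betaS (wP _ gAj) => y [x /(_ j)]; rewrite eqxx.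
have wmul j k : beta_map (fun y => (y j, y k)) w = arrow_filter (Defs.mul (Defs.inv (g j)) (g k)).
  have jk : src (Defs.inv (g j)) = rng (g k) by rewrite src_inv.
  apply: (@arrow_filter_inj _ _ r%:R).
  - by apply: betaS wr => y yr; exact: yr.
  - by rewrite Defs.rng_mul// rng_inv -wsrc; exact: beta_eq.
  - by rewrite Defs.src_mul// -wsrc; exact: beta_eq.
have wcvg j k : avg (y j, y k) @[y --> beta_filter w] -->
    boundary_kernel (Defs.mul (Defs.inv (g j)) (g k)).
  have := @boundary_kernel_cvg (Defs.mul (Defs.inv (g j)) (g k)).
  by rewrite -wmul; exact.
have wsum : \sum_j \sum_k sigma j * sigma k * avg (y j, y k) @[y --> beta_filter w] -->
    \sum_j \sum_k sigma j * sigma k * boundary_kernel (Defs.mul (Defs.inv (g j)) (g k)).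
  apply: cvg_big => [|j _]; first exact: add_continuous.
  apply: cvg_big => [|k _]; first exact: add_continuous.
  by apply: cvgMr; exact: wcvg.
apply/ler_addgt0Pr => e e0; rewrite add0r; apply: (cvgr_to_le wsum).
pose c := \sum_j \sum_k `|sigma j * sigma k| * ((4 * r)%:R * B r).
have b0 : boundary X (beta_map (fun y => y ord0) w) by rewrite wsrc; exact: unit_filter_boundary.
have wc : w [set y | c <= (N (y ord0))%:R * e] := small_quotient c b0 e0.
have wN : w [set y | (r + r < N (y ord0))%N] := slow_boundary (r + r) b0.
apply: betaS (betaI wr (betaI wc wN)) => y [/= yr [yc yN]].
rewrite -(@ler_pM2l _ (N (y ord0))%:R) ?ltr0n ?(leq_ltn_trans _ yN)//.
exact: le_trans (average_negative_type K (ltnW yN) yr s0) yc.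
Qed.

End BoundaryKernel.

Theorem theorem1 (R : realType) (X : metricType R)
  (Xud : uniformly_discrete X) (Xbg : bounded_geometry X)
  (Xfce : fibred_coarse_embedding X) :
  a_T_menable R (boundary_groupoid Xbg).
Proof.
have [phi [N [B K]]] := fibred_coarse_embedding_kernels Xfce.
exists (@boundary_kernel _ _ Xbg phi N); split.
- exact: boundary_kernel_continuous K.
- exact: boundary_kernel_proper K.
split.
- exact: boundary_kernel_idn K.
- exact: boundary_kernel_inv K.
- exact: boundary_kernel_negative_type K.
Qed.
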